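(* Let $d\ge1$ and $k\ge1$ be integers and suppose that $G=(V,E)$ is a $k$-fold $\mathcal{R}_d$-circuit such that every $(k-1)$-fold $\mathcal{R}_d$-circuit contained in $G$ is $\mathcal{R}_d$-rigid. Then $G$ is balanced.
   Context: For a graph $G=(V,E)$ and a generic $p:V\to\mathbb{R}^d$ (coordinates algebraically independent over $\mathbb{Q}$), the rigidity matrix $R(G,p)$ has a row for each $uv\in E$ with $p(u)-p(v)$ in the $d$ columns of $u$, $p(v)-p(u)$ in those of $v$, zeros elsewhere. The generic $d$-dimensional rigidity matroid $\mathcal{R}_d$ is its row matroid (on the edge set of a complete graph containing $G$), with rank function $r_d$ and closure $\mathrm{cl}(X)=\{x: r_d(X\cup\{x\})=r_d(X)\}$. Graphs are identified with their edge sets, and an edge set is regarded as the graph it spans. A graph $H=(W,F)$ is $\mathcal{R}_d$-rigid if it is a complete graph on at most $d+1$ vertices or $r_d(F)=d|W|-\binom{d+1}{2}$. A set of edges is cyclic if it is a union of $\mathcal{R}_d$-circuits. A graph $(V,D)$ is a $k$-fold $\mathcal{R}_d$-circuit if $D$ is cyclic and $r_d(D)=|D|-k$. Its principal partition is the partition $\{A_1,\dots,A_\ell\}$ of $D$ such that $\{D\setminus A_i\}$ is exactly the set of $(k-1)$-fold $\mathcal{R}_d$-circuits contained in $D$. It is balanced if $r_d\big(\bigcap_{i=1}^\ell \mathrm{cl}(D\setminus A_i)\big)=\ell-k$. *)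

(* Defs.v *)
From HB Require Import structures.
From mathcomp Require Import all_boot all_order all_algebra.
From mathcomp Require Import reals.
From mathcomp Require Import mpoly.
Set Implicit Arguments. Unset Strict Implicit. Unset Printing Implicit Defensive.
Import Order.TTheory GRing.Theory Num.Theory.
Local Open Scope ring_scope.

Definition edge (n : nat) := {e : 'I_n * 'I_n | (e.1 < e.2)%N}.

Section Rigidity.
Variables (R : realType) (n d : nat).

(* p : V -> R^d, given as an n x d matrix (row u = p(u)) *)
Implicit Types (p : 'M[R]_(n, d)) (F X : {set edge n}).

Definition generic p : Prop :=
  forall q : {mpoly rat[n * d]}, q != 0 ->
    (map_mpoly (ratr : rat -> R) q).@[fun j => mxvec p 0 j] != 0.

Definition rig_row p (e : edge n) : 'rV[R]_(n * d) :=
  let u := (val e).1 in let v := (val e).2 in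
  mxvec (\matrix_(w < n, i < d)
           (if w == u then p u i - p v i
            else if w == v then p v i - p u i else 0)).

Definition rig_mx p F : 'M[R]_(#|{: edge n}|, n * d) :=
  \matrix_(i < #|{: edge n}|)
     (if enum_val i \in F then rig_row p (enum_val i) else 0).

Definition rk p F : nat := \rank (rig_mx p F).

Definition cl p X : {set edge n} := [set x | rk p (x |: X) == rk p X].

Definition indep p F : bool := rk p F == #|F|.

Definition circuit p (C : {set edge n}) : bool :=
  ~~ indep p C && [forall e in C, indep p (C :\ e)].

Definition cyclic p (D : {set edge n}) : Prop :=
  exists S : {set {set edge n}},
    (forall C, C \in S -> circuit p C) /\ D = \bigcup_(C in S) C.

Definition kfold_circuit p (k : nat) (D : {set edge n}) : Prop :=
  cyclic p D /\ (rk p D + k)%N = #|D|.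

Definition vspan (F : {set edge n}) : {set 'I_n} :=
  [set w | [exists e in F, (w == (val e).1) || (w == (val e).2)]].

Definition complete_on (W : {set 'I_n}) : {set edge n} :=
  [set e : edge n | ((val e).1 \in W) && ((val e).2 \in W)].

Definition rigid p (F : {set edge n}) : Prop :=
  (F = complete_on (vspan F) /\ (#|vspan F| <= d.+1)%N)
  \/ (rk p F + 'C(d.+1, 2))%N = (d * #|vspan F|)%N.

Definition principal_partition p (k : nat) (D : {set edge n})
    (P : {set {set edge n}}) : Prop :=
  partition P D /\
  (forall C : {set edge n},
     (C \subset D /\ kfold_circuit p k.-1 C) <-> exists2 A, A \in P & C = D :\: A).

Definition balanced p (k : nat) (D : {set edge n}) : Prop :=
  exists P : {set {set edge n}},
    principal_partition p k D P /\
    (rk p (\bigcap_(A in P) cl p (D :\: A)) + k)%N = #|P|.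

End Rigidity.

(* Main.v *)
(** Let [A_1], ..., [A_l] be the coparallel classes of [D] and [U_i] the span of
    the rows of [D \ A_i].  Any intersection of some of the [U_i] contains the
    rows of the remaining classes, hence together with one further [U_j] spans
    everything; the modular law then gives [dim (U_1 /\ ... /\ U_l) = l - k],
    whatever the geometry.  What rigidity adds is that this intersection is
    spanned by edges: since [D \ A_i] is rigid, [U_i] is the span of the complete
    graph on its vertex set [V_i], which, [p] being in general position, is the
    space of all equilibrium loads supported on [V_i].  The equilibrium
    conditions do not depend on [i], so the intersection is the space of
    equilibrium loads supported on [V_1 /\ ... /\ V_l], i.e. the span of the
    complete graph on that set, all of whose edges lie in every closure. *)
Require Import Defs.
From HB Require Import structures.
From mathcomp Require Import all_boot all_order all_algebra.
From mathcomp Require Import reals.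
From mathcomp Require Import mpoly zify.
Set Implicit Arguments. Unset Strict Implicit. Unset Printing Implicit Defensive.
Import Order.TTheory GRing.Theory Num.Theory.

Lemma cardsD1S (T : finType) (A : {set T}) x : x \in A -> #|A| = #|A :\ x|.+1.
Proof. by move=> xA; rewrite (cardsD1 x) xA. Qed.

(** * Linear matroids and coparallel classes *)

Section LinearMatroid.
Local Open Scope ring_scope.
Variables (K : fieldType) (T : finType) (m : nat) (v : T -> 'rV[K]_m).
Implicit Types (A B C D F X Y : {set T}) (e f g : T).

(* The zero padding mirrors [rig_mx], so that [rig_mx p], [rk p], [circuit p],
   [cyclic p] are convertible to the notions below for the family [rig_row p]. *)
Definition fam_mx F : 'M[K]_(#|{: T}|, m) :=
  \matrix_(i < #|{: T}|) (if enum_val i \in F then v (enum_val i) else 0).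

Definition frk F : nat := \rank (fam_mx F).

Definition findep F : bool := frk F == #|F|.

Definition fcircuit C : bool := ~~ findep C && [forall e in C, findep (C :\ e)].

Definition fcyclic D : Prop :=
  exists S : {set {set T}},
    (forall C, C \in S -> fcircuit C) /\ D = \bigcup_(C in S) C.

Lemma fam_mx_subP F q (M : 'M[K]_(q, m)) :
  reflect {in F, forall e, (v e <= M)%MS} (fam_mx F <= M)%MS.
Proof.
apply: (iffP row_subP) => [sub e eF|sub i]; last first.
  by rewrite rowK; case: ifP => [/sub //|_]; rewrite sub0mx.
by have := sub (enum_rank e); rewrite rowK enum_rankK eF.
Qed.

Lemma fam_row_sub F e : e \in F -> (v e <= fam_mx F)%MS.
Proof. by move=> eF; move/fam_mx_subP: (submx_refl (fam_mx F)); apply. Qed.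

Lemma fam_mxS A B : A \subset B -> (fam_mx A <= fam_mx B)%MS.
Proof. by move=> /subsetP sAB; apply/fam_mx_subP => e /sAB/fam_row_sub. Qed.

Lemma frkS A B : A \subset B -> (frk A <= frk B)%N.
Proof. by move=> /fam_mxS/mxrankS. Qed.

(** For [e] in [X] the negation says that [e] is a bridge (coloop) of [X]. *)
Definition dep X e : bool := (v e <= fam_mx (X :\ e))%MS.

Lemma depS X Y e : X \subset Y -> dep X e -> dep Y e.
Proof. by move=> sXY /submx_trans; apply; apply/fam_mxS/setSD. Qed.

Lemma frk_setU1 X e :
  frk (e |: X) = (frk X + ~~ (v e <= fam_mx X)%MS)%N.
Proof.
have [eX|neX] /= := boolP (_ <= _)%MS.
  rewrite addn0; apply/eqP; rewrite eqn_leq (frkS (subsetUr _ _)) andbT.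
  apply: mxrankS; apply/fam_mx_subP => f /setU1P[-> //|]; exact: fam_row_sub.
apply/eqP; rewrite eqn_leq addn1; apply/andP; split; last first.
  rewrite (ltn_leqif (mxrank_leqif_sup (fam_mxS (subsetUr _ _)))).
  by apply: contra neX => /fam_mx_subP; apply; rewrite setU11.
have /mxrankS sub : (fam_mx (e |: X) <= fam_mx X + v e)%MS.
  apply/fam_mx_subP => f /setU1P[->|/fam_row_sub fX]; first exact: addsmxSr.
  exact: submx_trans fX (addsmxSl _ _).
apply: leq_trans sub _; apply: leq_trans (mxrank_adds_leqif _ _) _.
by rewrite -[leqRHS]addn1 leq_add2l rank_leq_row.
Qed.

Lemma frk_setD1 X e : e \in X -> frk X = (frk (X :\ e) + ~~ dep X e)%N.
Proof. by move=> eX; rewrite -{1}(setD1K eX) frk_setU1. Qed.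

Lemma frk0 : frk set0 = 0%N.
Proof.
by apply/eqP; rewrite mxrank_eq0 -submx0; apply/fam_mx_subP => e; rewrite inE.
Qed.

(** A bridge of [X] remains one in every smaller set containing it, so the elements of [B] can be
    deleted in turn, each costing one unit of rank. *)
Lemma frk_setD_bridges X B : B \subset X -> {in B, forall e, ~~ dep X e} ->
  (frk (X :\: B) + #|B|)%N = frk X.
Proof.
elim: {B}#|B| {-2}B (erefl #|B|) => [|r IHr] B mB sBX brB.
  by rewrite (cards0_eq mB) setD0 cards0 addn0.
have [e eB] : exists e, e \in B by apply/card_gt0P; rewrite mB.
have mB' : #|B :\ e| = r by apply: succn_inj; rewrite -mB -cardsD1S.
have brB' : {in B :\ e, forall f, ~~ dep X f} by move=> f /setD1P[_ /brB].
rewrite -{}(IHr _ mB' (subset_trans (subsetDl _ _) sBX) brB') mB' mB addnS -addSn.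
congr addn.
have eX : e \in X :\: (B :\ e) by rewrite !inE eqxx (subsetP sBX).
rewrite (frk_setD1 eX).
have -> : ~~ dep (X :\: (B :\ e)) e.
  by apply: contra (brB _ eB); apply: depS; apply: subsetDl.
rewrite addn1; congr (frk _).+1; apply/setP => f; rewrite !inE.
by case: eqP => [->|]; rewrite ?eB.
Qed.

Lemma frk_le_card X : (frk X <= #|X|)%N.
Proof.
elim: {X}#|X| {-2}X (erefl #|X|) => [|r IHr] X mX.
  by rewrite (cards0_eq mX) frk0.
have [e eX] : exists e, e \in X by apply/card_gt0P; rewrite mX.
have mX' : #|X :\ e| = r by apply: succn_inj; rewrite -mX -cardsD1S.
by move: (IHr _ mX'); rewrite (frk_setD1 eX) (cardsD1S eX); case: dep => /=; lia.
Qed.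

Lemma findepPn X : reflect (exists2 e, e \in X & dep X e) (~~ findep X).
Proof.
apply: (iffP idP) => [nX|[e eX de]].
  apply/exists_inP; apply: contraNT nX; rewrite negb_exists_in => /forall_inP br.
  by rewrite /findep -(frk_setD_bridges (subxx X) br) setDv frk0.
apply/negP => /eqP; rewrite (frk_setD1 eX) de addn0.
by move: (frk_le_card (X :\ e)); rewrite (cardsD1S eX) => + E; rewrite E ltnn.
Qed.

Lemma findepS X Y : X \subset Y -> findep Y -> findep X.
Proof.
move=> sXY; apply: contraLR => /findepPn[e eX dX]; apply/findepPn.
by exists e; [apply: (subsetP sXY) | apply: depS dX].
Qed.

(** The circuit is a minimal subset in which [e] still depends on the rest. A dependence among the
    other elements would allow one of them to be dropped. *)
Lemma dep_circuit X e : e \in X -> dep X e ->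
  exists C, [/\ fcircuit C, C \subset X & e \in C].
Proof.
move=> eX dX; pose P C := [&& C \subset X, e \in C & dep C e].
have [|C] := @minset_exists _ P X; first by rewrite /P subxx eX.
move=> /minsetP[/and3P[CX eC dC] minC] _; exists C; split=> //.
have min f : f \in C -> f != e -> ~~ dep (C :\ f) e.
  move=> fC fe; apply/negP => dCf.
  have Pf : P (C :\ f).
    by rewrite /P dCf andbT !inE eC eq_sym fe (subset_trans (subsetDl _ _)).
  by move/setP/(_ f): (minC _ Pf (subsetDl _ _)); rewrite !inE fC eqxx.
have iCe : findep (C :\ e).
  apply/negPn/findepPn => -[f /setD1P[fe fC] df].
  suff : dep (C :\ f) e by apply/negP/min.
  apply: (submx_trans dC); apply/fam_mx_subP => g gCe.
  have -> : C :\ f :\ e = C :\ e :\ f by apply/setP=> h; rewrite !inE andbCA.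
  have [-> //|gf] := eqVneq g f.
  by apply: fam_row_sub; rewrite in_setD1 gf.
apply/andP; split; first by apply/findepPn; exists e.
apply/forall_inP => f fC; have [-> //|fe] := eqVneq f e.
have eCf : e \in C :\ f by rewrite !inE eC eq_sym fe.
have /eqP iCfe : findep (C :\ f :\ e).
  by apply: findepS iCe; apply/setSD/subsetDl.
by rewrite /findep (frk_setD1 eCf) iCfe min // (cardsD1S eCf) addn1.
Qed.

(** Cyclic sets are the bridgeless ones, a form that only involves ranks of single deletions. *)
Lemma fcyclicP F : fcyclic F <-> {in F, forall e, dep F e}.
Proof.
split=> [[S [circS ->]] e /bigcupP[C CS eC]|dF].
  apply: (depS (bigcup_sup C CS)).
  have /andP[/negbTE nC /forall_inP /(_ e eC) iC] := circS _ CS.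
  have := frk_setD1 eC; move: iC nC; rewrite /findep => /eqP -> .
  by case: dep => //= /eqP; rewrite (cardsD1S eC); lia.
exists [set C in powerset F | fcircuit C]; split=> [C|].
  by rewrite inE => /andP[].
apply/eqP; rewrite eqEsubset; apply/andP; split; apply/subsetP => e.
  move=> eF; have [C [cC CF eC]] := dep_circuit eF (dF _ eF).
  by apply/bigcupP; exists C => //; rewrite !inE CF.
by case/bigcupP => C; rewrite !inE => /andP[/subsetP CF _] /CF.
Qed.

(** Adding an element raises the cardinality by one and the rank by at most one, so nullity is
    monotone. The additive form avoids truncated subtraction. *)
Lemma nullityS X Y : X \subset Y -> (#|X| + frk Y <= frk X + #|Y|)%N.
Proof.
move: {2}#|Y :\: X| (erefl #|Y :\: X|) => r; elim: r Y => [|r IHr] Y mY sXY.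
  suff -> : Y = X by rewrite addnC.
  by apply/eqP; rewrite eqEsubset sXY andbT -setD_eq0 -cards_eq0 mY.
have [e /setDP[eY eX]] : exists e, e \in Y :\: X.
  by apply/set0Pn; rewrite -card_gt0 mY.
have sXY' : X \subset Y :\ e by rewrite subsetD1 sXY.
have mY' : #|(Y :\ e) :\: X| = r.
  have -> : (Y :\ e) :\: X = (Y :\: X) :\ e.
    by apply/setP=> f; rewrite !inE andbCA.
  by apply: succn_inj; rewrite -mY -cardsD1S // inE eX.
move: (IHr _ mY' sXY') (frk_setD1 eY) (cardsD1S eY).
by case: dep => /=; lia.
Qed.

(** * Multiple circuits and their principal partition *)

Definition fkfold k D : Prop := fcyclic D /\ (frk D + k)%N = #|D|.

(* For a cyclic [D]: [e] and [f] are parallel in the dual of the matroid on [D]. *)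
Definition coparallel D e f : bool := (e == f) || ~~ dep (D :\ e) f.

Lemma setD1AC X e f : X :\ e :\ f = X :\ f :\ e.
Proof. by apply/setP=> g; rewrite !inE andbCA. Qed.

Lemma frk_cyclicD1 D e : fcyclic D -> e \in D -> frk (D :\ e) = frk D.
Proof.
by move=> /fcyclicP cD eD; rewrite (frk_setD1 eD) cD // addn0.
Qed.

(** Deleting [e] or [f] alone keeps the rank of [D], so for distinct elements both sides say that
    deleting the pair lowers it. *)
Lemma coparallel_sym D : fcyclic D -> {in D &, ssrbool.symmetric (coparallel D)}.
Proof.
move=> cD e f eD fD; rewrite /coparallel eq_sym; case: eqVneq => //= ef.
have fDe : f \in D :\ e by rewrite !inE ef.
have eDf : e \in D :\ f by rewrite !inE eq_sym ef.
move: (frk_setD1 fDe) (frk_setD1 eDf).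
rewrite (frk_cyclicD1 cD eD) (frk_cyclicD1 cD fD) setD1AC => ->.
by do 2 case: dep => //=; lia.
Qed.

(** If [e] and [g] are bridges of [D :\ f], deleting all three elements costs rank two. Were [g] not
    a bridge of [D :\ e], deleting [e] and [g] would be free, and [f] alone can cost only one. *)
Lemma coparallel_trans D e f g : fcyclic D -> e \in D -> f \in D -> g \in D ->
  coparallel D e f -> coparallel D f g -> coparallel D e g.
Proof.
move=> cD eD fD gD; rewrite (coparallel_sym cD eD fD) /coparallel.
have [->|fe] //= := eqVneq f e.
have [<-|fg] //= := eqVneq f g.
  by move=> de _; have := coparallel_sym cD eD fD; rewrite /coparallel de orbT.
have [//|eg /= de dg] := eqVneq e g; apply/negP => deg.
have sB : [set e; g] \subset D :\ f.
  by rewrite subUset !sub1set !inE eD gD eq_sym fe eq_sym fg.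
have := frk_setD_bridges sB; rewrite cards2 eg frk_cyclicD1 // => br.
have {}br : (frk (D :\ f :\: [set e; g]) + 2)%N = frk D.
  by apply: br => h /set2P[] ->.
have gDe : g \in D :\ e by rewrite !inE eq_sym eg.
have := frk_setD1 gDe; rewrite deg frk_cyclicD1 // addn0 => frkD.
have fDeg : f \in D :\ e :\ g by rewrite !inE fe fg.
move: br; rewrite frkD (frk_setD1 fDeg).
have -> : D :\ f :\: [set e; g] = D :\ e :\ g :\ f.
  by apply/setP => h; rewrite !inE; case: eqP; case: eqP; case: eqP.
by move/eqP; rewrite eqn_add2l; case: dep.
Qed.

Lemma coparallel_equiv D :
  fcyclic D -> {in D & &, equivalence_rel (coparallel D)}.
Proof.
move=> cD e f g eD fD gD; rewrite {1}/coparallel eqxx; split=> // ef.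
apply/idP/idP => [eg|]; last exact: coparallel_trans.
by apply: coparallel_trans eg => //; rewrite coparallel_sym.
Qed.

Definition coclass D e : {set T} := [set f in D | coparallel D e f].

Definition coclasses D : {set {set T}} := equivalence_partition (coparallel D) D.

Lemma coclassesP D A :
  reflect (exists2 e, e \in D & A = coclass D e) (A \in coclasses D).
Proof. exact: imsetP. Qed.

(** Deleting [e] from [Y] is free, and then the rest of its class consists of bridges. Besides
    [Y = D], the case [Y = D :\ g] is needed to show that removing a class creates no bridge [g]. *)
Lemma frk_setD_coclass D Y e : e \in D -> Y \subset D ->
  coclass D e \subset Y -> dep Y e ->
  (frk (Y :\: coclass D e) + #|coclass D e| = (frk Y).+1)%N.
Proof.
move=> eD sYD sAY dY; set A := coclass D e.
have eA : e \in A by rewrite inE eD /coparallel eqxx.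
have eY : e \in Y by apply: (subsetP sAY).
have -> : Y :\: A = (Y :\ e) :\: (A :\ e).
  apply/setP => f; rewrite !inE; case: eqP => [->|] //.
  by rewrite /coparallel eqxx eD.
have br : {in A :\ e, forall f, ~~ dep (Y :\ e) f}.
  move=> f; rewrite !inE eq_sym => /and3P[/negbTE fe fD]; rewrite /coparallel fe /=.
  by apply: contra; apply/depS/setSD.
rewrite (cardsD1S eA) addnS frk_setD_bridges ?setSD //.
by rewrite (frk_setD1 eY) dY addn0.
Qed.

Lemma kfold_setD_coclass k D A : (0 < k)%N -> fkfold k D -> A \in coclasses D ->
  [/\ A \subset D, fkfold k.-1 (D :\: A) & (frk (D :\: A) + #|A| = (frk D).+1)%N].
Proof.
move=> k0 [cD nD] /coclassesP[e eD ->].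
have sAD : coclass D e \subset D by apply/subsetP => f; rewrite inE => /andP[].
have rA : (frk (D :\: coclass D e) + #|coclass D e| = (frk D).+1)%N.
  by apply: frk_setD_coclass => //; move/fcyclicP: cD; apply.
split=> //; split.
  apply/fcyclicP => g /setDP[gD gA].
  have sY : D :\ g \subset D by apply: subsetDl.
  have sAY : coclass D e \subset D :\ g by rewrite subsetD1 sAD.
  have eg : e != g by apply: contraNneq gA => <-; rewrite inE eD /coparallel eqxx.
  have dY : dep (D :\ g) e.
    move: gA; rewrite inE gD coparallel_sym //= /coparallel eq_sym (negbTE eg) /=.
    by rewrite negbK.
  have := frk_setD_coclass eD sY sAY dY.
  have gDA : g \in D :\: coclass D e by rewrite inE gA.
  have -> : D :\ g :\: coclass D e = (D :\: coclass D e) :\ g.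
    by apply/setP => f; rewrite !inE andbCA.
  have := frk_setD1 gDA; rewrite (frk_cyclicD1 cD gD).
  by case: dep => //=; lia.
by move: (cardsID (coclass D e) D); rewrite (setIidPr sAD); lia.
Qed.

(** If a bridgeless [C] misses [e], it misses the whole class [A] of [e]. Both [C] and [D :\: A]
    have nullity [k - 1]; as deleting any element of the bridgeless [D :\: A] lowers the nullity,
    monotonicity forces equality. *)
Lemma coclasses_kfold k D C : (0 < k)%N -> fkfold k D ->
  (C \subset D /\ fkfold k.-1 C) <-> exists2 A, A \in coclasses D & C = D :\: A.
Proof.
move=> k0 fD; split=> [[sCD [cC nC]]|[A AP ->]]; last first.
  by have [_ ? _] := kfold_setD_coclass k0 fD AP; split=> //; apply: subsetDl.
have [cD nD] := fD.
have /properP[_ [e eD eC]] : C \proper D.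
  rewrite properEneq sCD andbT; apply/negP => /eqP CD.
  by move: nC nD; rewrite CD; lia.
have AP : coclass D e \in coclasses D by apply/coclassesP; exists e.
have [sAD [/fcyclicP cDA nDA] _] := kfold_setD_coclass k0 fD AP.
have sCA : C \subset D :\: coclass D e.
  apply/subsetP => g gC; rewrite !inE (subsetP sCD) //= andbT.
  rewrite /coparallel negb_or negbK.
  apply/andP; split; first by apply: contraNneq eC => ->.
  have sCDe : C \subset D :\ e by rewrite subsetD1 sCD.
  by apply: (depS sCDe); move/fcyclicP: cC; apply.
exists (coclass D e) => //; apply/eqP; rewrite eqEsubset sCA /=.
apply/subsetP => g gDA; apply: contraT => gC.
have sC : C \subset (D :\: coclass D e) :\ g by rewrite subsetD1 sCA.
move: (nullityS sC) (frk_setD1 gDA) (cardsD1S gDA); rewrite cDA //=; lia.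
Qed.

(** Imposing the classes one at a time, the modular law lowers the dimension by [#|A| - 1] for each
    [A]. The total drop from [frk D] is [#|D|] minus the number of classes. *)
Lemma rank_bigcap_coclasses k D : (0 < k)%N -> fkfold k D ->
  (\rank (\bigcap_(A in coclasses D) <<fam_mx (D :\: A)>>) + k)%N = #|coclasses D|.
Proof.
move=> k0 fD; have [cD nD] := fD.
have parD := equivalence_partitionP (coparallel_equiv cD).
have /and3P[covD trivD _] := parD.
have disj A B e : A \in coclasses D -> B \in coclasses D -> A != B -> e \in A ->
    e \notin B.
  move=> AP BP AB; apply: contraL => eB; apply: (contraNN _ AB) => eA.
  by rewrite -(def_pblock trivD AP eA) -(def_pblock trivD BP eB).
(* The factor for [D] makes the empty intersection equal to the span of [D] rather than the whole
   space. *)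
pose I (Q : {set {set T}}) :=
  (<<fam_mx D>> :&: \bigcap_(A in Q) <<fam_mx (D :\: A)>>)%MS.
have rI r (Q : {set {set T}}) : #|Q| = r -> Q \subset coclasses D ->
    (\rank (I Q) + \sum_(A in Q) #|A| = frk D + r)%N.
  elim: r Q => [|r IHr] Q.
    by move/cards0_eq => -> _; rewrite /I !big_set0 !addn0 capmx1 genmxE.
  move=> rQ sQ; have /set0Pn[A AQ] : Q != set0 by rewrite -card_gt0 rQ.
  have AP : A \in coclasses D by apply: (subsetP sQ).
  have rQ' : #|Q :\ A| = r by apply: succn_inj; rewrite -rQ -cardsD1S.
  have {IHr} IH := IHr _ rQ' (subset_trans (subsetDl _ _) sQ).
  have [sAD _ rA] := kfold_setD_coclass k0 fD AP.
  have capE : (I Q = I (Q :\ A) :&: <<fam_mx (D :\: A)>>)%MS.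
    by rewrite /I (big_setD1 A) //= -capmxA; congr (_ :&: _)%MS; apply: capmxC.
  (* Elements outside [A] lie in [D :\: A]; those of [A] lie in [D :\: B] for every other class [B],
     by disjointness. *)
  have sumE : (I (Q :\ A) + <<fam_mx (D :\: A)>> :=: fam_mx D)%MS.
    apply/eqmxP/andP; split.
      rewrite addsmx_sub genmxE fam_mxS ?subsetDl // andbT.
      by apply: submx_trans (capmxSl _ _) _; rewrite genmxE.
    apply/fam_mx_subP => e eD; have [eA|eA] := boolP (e \in A); last first.
      by apply: submx_trans (addsmxSr _ _); rewrite genmxE fam_row_sub // inE eA.
    apply: submx_trans (addsmxSl _ _); rewrite sub_capmx genmxE fam_row_sub //=.
    apply/sub_bigcapmxP => B /setD1P[BA BQ]; rewrite genmxE fam_row_sub // inE eD.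
    by rewrite (disj A) // ?(subsetP sQ) // eq_sym.
  move: (mxrank_sum_cap (I (Q :\ A)) <<fam_mx (D :\: A)>>%MS).
  have -> : (\sum_(B in Q) #|B| = #|A| + \sum_(B in Q :\ A) #|B|)%N.
    exact: big_setD1.
  rewrite sumE -capE genmxE -/(frk D) -/(frk (D :\: A)).
  move: IH rA; move: (\rank _) (\rank _) (\sum_(B in _) _)%N => a b c.
  by lia.
have := rI _ _ (erefl #|coclasses D|) (subxx _).
rewrite -(card_partition parD) -nD.
(* As [k > 0], [D] is nonempty and has a class, so the factor for [D] is absorbed. *)
have -> : (I (coclasses D) :=: \bigcap_(A in coclasses D) <<fam_mx (D :\: A)>>)%MS.
  apply: capmx_idPr.
  have [e eD] : exists e, e \in D by apply/set0Pn; rewrite -card_gt0 -nD; lia.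
  have AP : coclass D e \in coclasses D by apply/coclassesP; exists e.
  apply: submx_trans (bigcapmx_inf _ AP (submx_refl _)) _.
  by rewrite !genmxE fam_mxS ?subsetDl.
by lia.
Qed.

End LinearMatroid.

(** * Generic configurations *)

Lemma widen_ord_inj (m q : nat) (le_mq : (m <= q)%N) : injective (widen_ord le_mq).
Proof. by move=> i j /(congr1 val) /= /val_inj. Qed.

Section GenericPosition.
Local Open Scope ring_scope.
Variables (R : realType) (n d : nat) (p : 'M[R]_(n, d)).
Hypothesis gen_p : generic p.

(** The determinant is a polynomial in the coordinates with rational coefficients, so by genericity
    it suffices that this polynomial is nonzero. *)
Lemma generic_det m (f : 'I_m -> 'I_n) (h : 'I_m -> 'I_d) (y : 'I_n) :
  injective f -> injective h -> (forall i, f i != y) ->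
  \det (\matrix_(i, j) (p (f i) (h j) - p y (h j))) != 0.
Proof.
move=> inj_f inj_h fy.
pose x u j : {mpoly rat[n * d]} := 'X_(mxvec_index u j).
pose q := \det (\matrix_(i, j) (x (f i) (h j) - x y (h j))).
have q0 : q != 0.
  (* At this rational point the matrix becomes the identity. *)
  pose t : 'M[rat]_(n, d) := \matrix_(u, j) [exists i, (u == f i) && (j == h i)]%:R.
  apply: contraTneq isT => /(congr1 (meval (fun k => mxvec t 0 k))).
  rewrite meval0 -det_map_mx.
  suff -> : map_mx (meval (fun k => mxvec t 0 k))
      (\matrix_(i, j) (x (f i) (h j) - x y (h j))) = 1%:M.
    by rewrite det1 => /eqP; rewrite oner_eq0.
  apply/matrixP => i j; rewrite !mxE mevalB !mevalXU !mxvecE !mxE.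
  have -> : [exists i0, (y == f i0) && (h j == h i0)] = false.
    by apply/existsP => -[i0 /andP[/eqP yf _]]; move: (fy i0); rewrite -yf eqxx.
  rewrite subr0; congr (_%:R); congr nat_of_bool.
  apply/existsP/eqP => [[i0 /andP[/eqP/inj_f -> /eqP/inj_h ->]] //|->].
  by exists j; rewrite !eqxx.
move: (gen_p q0); apply: contra => /eqP det0; apply/eqP.
rewrite -[RHS]det0 -!det_map_mx; congr (\det _); apply/matrixP => i j.
by rewrite !mxE rmorphB /= !map_mpolyX mevalB !mevalXU !mxvecE.
Qed.

Lemma generic_indep (y : 'I_n) (Z : {set 'I_n}) (a : 'I_n -> R) :
  y \notin Z -> (#|Z| <= d)%N ->
  \sum_(z in Z) a z *: (row z p - row y p) = 0 -> {in Z, forall z, a z = 0}.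
Proof.
move=> yZ Zd sum0 z zZ.
have fy (i : 'I_#|Z|) : enum_val i != y.
  by apply: contraNneq yZ => <-; apply: enum_valP.
have := generic_det enum_val_inj (@widen_ord_inj _ _ Zd) fy.
rewrite -unitfE -unitmxE; set M := \matrix_(i, j) _ => uM.
have : (\row_i a (enum_val i)) *m M = 0 :> 'rV_#|Z|.
  apply/rowP => j; rewrite !mxE.
  have /rowP/(_ (widen_ord Zd j)) := sum0; rewrite summxE big_enum_val mxE => E.
  rewrite -[RHS]E.
  by apply: eq_bigr => i _; rewrite !mxE.
move/(canRL (mulmxK uM)); rewrite mul0mx => /rowP/(_ (enum_rank_in zZ z)).
by rewrite !mxE enum_rankK_in.
Qed.

(** Any [d] points of [Z] already give an invertible square matrix of offsets from [y]. *)
Lemma generic_span (y : 'I_n) (Z : {set 'I_n}) (c : 'cV[R]_d) :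
  y \notin Z -> (d <= #|Z|)%N ->
  {in Z, forall z, (row z p - row y p) *m c = 0} -> c = 0.
Proof.
move=> yZ Zd c0.
pose f (i : 'I_d) := enum_val (widen_ord Zd i).
have inj_f : injective f by move=> i j /enum_val_inj/(@widen_ord_inj _ _ Zd).
have fy i : f i != y.
  by apply: contraNneq yZ => <-; apply: enum_valP.
have := generic_det inj_f (@inj_id _) fy.
rewrite -unitfE -unitmxE; set M := \matrix_(i, j) _ => uM.
suff : M *m c = 0 by move/(canRL (mulKmx uM)); rewrite mulmx0.
apply/row_matrixP => i; rewrite row_mul row0 -(c0 (f i)) ?enum_valP //.
by congr (_ *m _); apply/rowP => j; rewrite !mxE.
Qed.

End GenericPosition.

(** * Equilibrium loads *)

Section Equilibrium.
Local Open Scope ring_scope.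
Variables (R : realType) (n d : nat) (p : 'M[R]_(n, d)).
Implicit Types (u x y z : 'I_n) (Y Z : {set 'I_n}) (w : 'M[R]_(n, d)).

(** This is the rigidity row of the pair, reshaped as a matrix of forces. Unlike [edge], it accepts
    the endpoints in either order, or equal. *)
Definition bar x y : 'M[R]_(n, d) :=
  (delta_mx 0 x - delta_mx 0 y : 'rV_n)^T *m (row x p - row y p).

(* Forces [row x w] applied at the points [row x p]: the last condition, the
   symmetry of [\sum_x p(x)^T w(x)], says that the total torque vanishes. *)
Definition equil Y w : Prop :=
  [/\ forall x, x \notin Y -> row x w = 0,
      const_mx 1 *m w = 0 :> 'rV_d &
      (p^T *m w)^T = p^T *m w].

Lemma row_bar u x y :
  row u (bar x y) = ((u == x)%:R - (u == y)%:R) *: (row x p - row y p).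
Proof.
by apply/rowP => j; rewrite !mxE big_ord1 !mxE !eqxx.
Qed.

Lemma barC x y : bar x y = bar y x.
Proof.
apply/row_matrixP => i.
by rewrite !row_bar -[row y p - _]opprB scalerN -scaleNr opprB.
Qed.

Lemma barxx x : bar x x = 0.
Proof. by rewrite /bar subrr trmx0 mul0mx. Qed.

Lemma rig_row_bar (e : edge n) : rig_row p e = mxvec (bar (val e).1 (val e).2).
Proof.
have ne : (val e).1 != (val e).2 by rewrite neq_ltn (valP e).
congr mxvec; apply/matrixP => i j.
transitivity (row i (bar (val e).1 (val e).2) 0 j); last by rewrite mxE.
rewrite row_bar !mxE; have [->|_] := eqVneq i (val e).1.
  by rewrite (negbTE ne) subr0 mul1r.
by case: eqP => _; rewrite sub0r ?oppr0 ?mul0r // mulN1r opprB.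
Qed.

Lemma equil0 Y : equil Y 0.
Proof. by split=> [x _||]; rewrite ?mulmx0 ?row0 // trmx0. Qed.

Lemma equilD Y w1 w2 : equil Y w1 -> equil Y w2 -> equil Y (w1 + w2).
Proof.
move=> [s1 f1 t1] [s2 f2 t2]; split=> [x xY||].
- by rewrite raddfD /= s1 // s2 // addr0.
- by rewrite mulmxDr f1 f2 addr0.
- by rewrite mulmxDr raddfD /= t1 t2.
Qed.

Lemma equilZ Y a w : equil Y w -> equil Y (a *: w).
Proof.
move=> [s f t]; split=> [x xY||].
- by rewrite linearZ /= s // scaler0.
- by rewrite -scalemxAr f scaler0.
- by rewrite -scalemxAr linearZ /= t.
Qed.

Lemma equil_sum Y (I : finType) (P : pred I) (F : I -> 'M[R]_(n, d)) :
  (forall i, P i -> equil Y (F i)) -> equil Y (\sum_(i | P i) F i).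
Proof. by apply: big_ind; [apply: equil0 | apply: equilD]. Qed.

Lemma equil_bar Y x y : x \in Y -> y \in Y -> equil Y (bar x y).
Proof.
move=> xY yY; split=> [u uY||].
- rewrite row_bar.
  have /negbTE -> : u != x by apply: contraNneq uY => ->.
  have /negbTE -> : u != y by apply: contraNneq uY => ->.
  by rewrite subrr scale0r.
- apply/rowP => j; rewrite mulmxA !mxE big_ord1 !mxE.
  rewrite (eq_bigr (fun i => (i == x)%:R - (i == y)%:R)).
    rewrite sumrB.
    rewrite (bigD1 x) //= big1 => [|i /negbTE ->] //; rewrite eqxx addr0.
    rewrite (bigD1 y) //= big1 => [|i /negbTE ->] //.
    by rewrite eqxx addr0 subrr mul0r.
  by move=> i _; rewrite !mxE !eqxx mul1r.
(* With [a] the difference of unit rows, the bar is [a^T *m (a *m p)], so its torque matrix is the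
   symmetric [(a *m p)^T *m (a *m p)]. *)
- have -> : bar x y = (delta_mx 0 x - delta_mx 0 y : 'rV_n)^T *m
      ((delta_mx 0 x - delta_mx 0 y : 'rV_n) *m p) by rewrite mulmxBl -!rowE.
  by rewrite [p^T *m _]mulmxA -trmx_mul; move: (_ *m p) => a; rewrite trmx_mul trmxK.
Qed.

Lemma equil_sub (F : {set edge n}) Y (v : 'rV_(n * d)) : F \subset complete_on Y ->
  (v <= rig_mx p F)%MS -> equil Y (vec_mx v).
Proof.
move=> sFY /submxP[a ->]; rewrite mulmx_sum_row linear_sum /=.
apply: equil_sum => i _; rewrite linearZ /=; apply: equilZ.
rewrite rowK; case: ifP => [iF|_]; last by rewrite linear0; apply: equil0.
move: (subsetP sFY _ iF); rewrite inE => /andP[? ?].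
by rewrite rig_row_bar mxvecK; apply: equil_bar.
Qed.

Lemma bar_sub Y x y : x \in Y -> y \in Y ->
  (mxvec (bar x y) <= rig_mx p (complete_on Y))%MS.
Proof.
wlog le_xy : x y / (x <= y)%N => [th xY yY|xY yY].
  by have [/th|/ltnW/th] := leqP x y; [|rewrite barC]; apply.
move: le_xy; rewrite leq_eqVlt => /predU1P[/val_inj ->|lt_xy].
  by rewrite barxx linear0 sub0mx.
pose e : edge n := Sub (x, y) lt_xy.
have := @fam_row_sub _ _ _ (rig_row p) (complete_on Y) e.
by rewrite rig_row_bar; apply; rewrite inE xY.
Qed.

Lemma complete_onS Y Z : Y \subset Z -> complete_on Y \subset complete_on Z.
Proof.
by move=> /subsetP sYZ; apply/subsetP => e; rewrite !inE => /andP[/sYZ -> /sYZ ->].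
Qed.

Hypothesis gen_p : generic p.

Definition offset_mx y Z : 'M[R]_(n, d) :=
  \matrix_(z < n) (if z \in Z then row z p - row y p else 0).

(* Cartan's lemma: a vector [c] orthogonal to all [p(z) - p(y)], contracted with
   the torque condition, gives [\sum_z (w(z) c) (p(z) - p(y)) = 0]; if the offsets
   are independent then [w(z) c = 0] for [z <> y], and the force condition gives
   [w(y) c = 0].  If instead the offsets span, then [c = 0]. *)
Lemma equil_row Y w y : equil Y w -> y \in Y ->
  (row y w <= offset_mx y (Y :\ y))%MS.
Proof.
move=> [supp force torque] yY; set Z := Y :\ y.
have yZ : y \notin Z by rewrite setD11.
rewrite submxE; apply/eqP/row_matrixP => i0; rewrite row0 {i0}row_id.
apply/rowP => j; set N := cokermx _; pose c := col j N.
have mul_c q (A : 'M_(q, d)) : A *m c = col j (A *m N) by rewrite /c !colE mulmxA.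
suff : row y w *m c = 0.
  by rewrite mul_c => /matrixP/(_ 0 0); rewrite mxE => ->; rewrite !mxE.
have c0 z : z \in Z -> (row z p - row y p) *m c = 0.
  move=> zZ; have <- : row z (offset_mx y Z) = row z p - row y p by rewrite rowK zZ.
  by rewrite -row_mul mul_c mulmx_coker !raddf0.
have [dZ|/ltnW Zd] := leqP d #|Z|.
  by rewrite (generic_span gen_p yZ dZ c0) mulmx0.
(* Moving the origin to [p(y)] leaves the torque unchanged because the total force is zero. *)
pose q := p - const_mx 1 *m row y p.
have rq x : row x q = row x p - row y p.
  by apply/rowP => i; rewrite !mxE big_ord1 !mxE mul1r.
have qw : q^T *m w = p^T *m w.
  rewrite raddfB /= trmx_mul mulmxBl -mulmxA trmx_const force mulmx0 subr0 //.
have sym : (w *m c)^T *m q = (q *m c)^T *m w.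
  by rewrite !trmx_mul -!mulmxA; congr mulmx; rewrite qw -torque -qw trmx_mul trmxK.
have sum0 : \sum_(z in Z) (w *m c) z 0 *: (row z p - row y p) = 0.
  transitivity ((w *m c)^T *m q).
    rewrite mulmx_sum_row [RHS](bigID (mem Z)) /= [X in _ + X]big1 => [|x xZ].
      by rewrite addr0; apply: eq_bigr => z _; rewrite rq [_^T 0 z]mxE.
    rewrite rq; have [->|xy] := eqVneq x y; first by rewrite subrr scaler0.
    have xY : x \notin Y by move: xZ; rewrite !inE xy.
    have := congr1 (fun M => (M *m c) 0 0) (supp x xY).
    by rewrite -row_mul mul0mx !mxE => ->; rewrite scale0r.
  rewrite sym mulmx_sum_row big1 // => x _.
  have [xY|/supp->] := boolP (x \in Y); last by rewrite scaler0.
  suff /matrixP/(_ 0 0) : row x q *m c = 0.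
    by rewrite -row_mul !mxE => ->; rewrite scale0r.
  rewrite rq; have [->|xy] := eqVneq x y; first by rewrite subrr mul0mx.
  by apply: c0; rewrite !inE xy.
have wc0 := generic_indep gen_p yZ Zd sum0.
apply/matrixP => a b; rewrite !ord1 -row_mul !mxE.
have := congr1 (fun M => (M *m c) 0 0) force.
rewrite -mulmxA mul0mx [LHS]mxE [RHS]mxE (bigD1 y) //= big1 => [|x xy].
  by rewrite addr0 !mxE mul1r.
rewrite [const_mx 1 0 x]mxE mul1r; have [xY|xY] := boolP (x \in Y).
  by apply: wc0; rewrite !inE xy.
have := congr1 (fun M => (M *m c) 0 0) (supp x xY).
by rewrite -row_mul mul0mx !mxE.
Qed.

Lemma equil_setD1 Y y w : equil Y w -> row y w = 0 -> equil (Y :\ y) w.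
Proof.
move=> [supp force torque] wy; split=> // x; rewrite !inE negb_and negbK.
by case/predU1P => [->|/supp].
Qed.

(** Converse of [equil_sub], by induction on [Y]: the force at a vertex [y] is cancelled by bars
    from [y] to the other vertices, leaving an equilibrium load on [Y :\ y]. *)
Lemma equil_complete Y w : equil Y w -> (mxvec w <= rig_mx p (complete_on Y))%MS.
Proof.
move: {2}#|Y| (erefl #|Y|) => r; elim: r Y w => [|r IHr] Y w.
  move/cards0_eq => -> [supp _ _].
  suff -> : w = 0 by rewrite linear0 sub0mx.
  by apply/row_matrixP => i; rewrite supp ?inE // row0.
move=> Yr eqw; have /set0Pn[y yY] : Y != set0 by rewrite -card_gt0 Yr.
have Yr' : #|Y :\ y| = r by apply: succn_inj; rewrite -Yr -cardsD1S.
have /submxP[a wa] := equil_row eqw yY.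
pose b := \sum_(z in Y :\ y) a 0 z *: bar y z.
have eqb : equil Y b.
  apply: equil_sum => z /setD1P[_ zY]; apply/equilZ; exact: equil_bar.
have sub_b : (mxvec b <= rig_mx p (complete_on Y))%MS.
  rewrite linear_sum /=; apply: summx_sub => z /setD1P[_ zY].
  by rewrite linearZ /= scalemx_sub // bar_sub.
have row_b : row y (w + b) = 0.
  rewrite raddfD /= wa mulmx_sum_row linear_sum (bigID (mem (Y :\ y))) /=.
  rewrite [X in _ + X + _]big1 ?addr0 => [|z zY]; last first.
    by rewrite rowK (negbTE zY) scaler0.
  rewrite -big_split big1 //= => z zY; rewrite rowK zY linearZ /= row_bar eqxx.
  move: zY; rewrite !inE eq_sym => /andP[/negbTE -> _]; rewrite subr0 scale1r.
  by rewrite -scalerDr addrC addrA subrK subrr scaler0.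
have /(IHr _ _ Yr') sub := equil_setD1 (equilD eqw eqb) row_b.
rewrite -(addrK b w) linearB /= addmx_sub ?eqmx_opp //.
apply: submx_trans sub _; apply: (@fam_mxS _ _ _ (rig_row p)).
exact/complete_onS/subsetDl.
Qed.

(** * Rank of complete graphs and span of rigid cyclic sets *)

Definition row_lin y : 'M[R]_(n * d, d) := lin1_mx (row y \o vec_mx).

Lemma mul_row_lin y (v : 'rV_(n * d)) : v *m row_lin y = row y (vec_mx v).
Proof. by rewrite mul_rV_lin1. Qed.

Lemma subset_complete_vspan (F : {set edge n}) : F \subset complete_on (vspan F).
Proof.
apply/subsetP => e eF; rewrite !inE.
by apply/andP; split; apply/existsP; exists e; rewrite eF eqxx ?orbT.
Qed.

Lemma card_complete_on Y : (#|complete_on Y| <= 'C(#|Y|, 2))%N.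
Proof.
rewrite -cards_draws.
rewrite -(card_in_imset (f := fun e : edge n => [set (val e).1; (val e).2])).
  apply/subset_leq_card/subsetP => _ /imsetP[e + ->].
  rewrite !inE subUset !sub1set => -> /=.
  by rewrite cards2 neq_ltn (valP e).
move=> [[a b] ab] [[a' b'] ab'] _ _ /= /setP E; apply: val_inj => /=.
move: (E a) (E b) (E a') (E b'); rewrite !inE !eqxx ?orbT /= -!val_eqE /=.
move=> /= *; congr pair; apply: val_inj; move: ab ab' => /=; lia.
Qed.

(** Loads vanishing at [y] are equilibrium loads on [Y :\ y], so each vertex adds at most [d] to the
    rank. The induction starts at [d + 1] vertices, where counting edges suffices. *)
Lemma rk_complete_on Y : (d < #|Y|)%N ->
  (rk p (complete_on Y) + 'C(d.+1, 2) <= d * #|Y|)%N.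
Proof.
move=> dY; rewrite -(subnKC dY); move: (subnKC dY).
move: (#|Y| - d.+1)%N => r; elim: r Y {dY} => [|r IHr] Y Yr.
  have := card_complete_on Y; rewrite -Yr addn0.
  have : (rk p (complete_on Y) <= #|complete_on Y|)%N.
    exact: (@frk_le_card _ _ _ (rig_row p)).
  have := bin_ffact d.+1 2; rewrite !ffactnS ffactn0 muln1 /= => Eb le1 le2.
  have {le1 le2} := leq_trans le1 le2; rewrite (_ : 2`! = 2)%N // in Eb.
  by rewrite [(d * _)%N]mulnC -Eb muln2 -addnn leq_add2r.
have /set0Pn[y yY] : Y != set0 by rewrite -card_gt0 -Yr.
have /IHr IH : (d.+1 + r)%N = #|Y :\ y|.
  by apply: succn_inj; rewrite -cardsD1S // -Yr addnS.
have sub : (rig_mx p (complete_on Y) :&: kermx (row_lin y)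
            <= rig_mx p (complete_on (Y :\ y)))%MS.
  apply/rV_subP => v; rewrite sub_capmx => /andP[/(equil_sub (subxx _)) eqv].
  move/sub_kermxP; rewrite mul_row_lin => v0.
  by rewrite -[v]vec_mxK; apply/equil_complete/equil_setD1.
rewrite /rk -(mxrank_mul_ker (rig_mx p (complete_on Y)) (row_lin y)).
rewrite addnS mulnS -addnA; apply: leq_add (rank_leq_col _) _.
by apply: leq_trans IH; rewrite leq_add2r; apply: mxrankS.
Qed.

(** At most [d + 1] generic points are affinely independent. Hence the forces at [u] exerted by the
    edges at [u] are independent, and any edge would be a bridge. *)
Lemma cyclic_small (F : {set edge n}) :
  cyclic p F -> (#|vspan F| <= d.+1)%N -> F = set0.
Proof.
move=> cF cardV; apply/eqP/set0Pn => -[e eF].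
have /(@fcyclicP _ _ _ (rig_row p))/(_ e eF) := cF.
set u := (val e).1; set x := (val e).2; set V := vspan F in cardV *.
rewrite /dep => /(submxMr (row_lin u)); rewrite mul_row_lin rig_row_bar mxvecK.
have ux : (u < x)%N := valP e.
have nux : u != x by rewrite neq_ltn ux.
have /andP[uV xV] : (u \in V) && (x \in V).
  by have := subsetP (subset_complete_vspan F) _ eF; rewrite inE.
rewrite row_bar eqxx (negbTE nux) subr0 scale1r.
have sub : (rig_mx p (F :\ e) *m row_lin u <= offset_mx u (V :\ u :\ x))%MS.
  have inO z : z \in V -> z != u -> z != x ->
      (row z p - row u p <= offset_mx u (V :\ u :\ x))%MS.
    move=> zV zu zx.
    have <- : row z (offset_mx u (V :\ u :\ x)) = row z p - row u p.
      by rewrite rowK !in_setD1 zu zx zV.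
    exact: row_sub.
  apply/row_subP => i; rewrite row_mul rowK mul_row_lin.
  case: ifP => [|_]; last by rewrite linear0 row0 sub0mx.
  move: (enum_val i) => f /setD1P[fe fF].
  rewrite rig_row_bar mxvecK row_bar.
  have /andP[f1V f2V] : ((val f).1 \in V) && ((val f).2 \in V).
    by have := subsetP (subset_complete_vspan F) _ fF; rewrite inE.
  have f12 : ((val f).1 < (val f).2)%N := valP f.
  (* Only an edge [f] at [u] contributes. Its other end is not [x]: if [u] is the smaller end
     because [f] differs from [e], and otherwise because that end is below [u], hence below [x]. *)
  have [uf1|_] := eqVneq u (val f).1.
    apply: scalemx_sub; rewrite -opprB eqmx_opp -uf1; apply: inO => //.
      by rewrite uf1 eq_sym neq_ltn f12.
    apply: contraNneq fe => f2; apply/eqP/val_inj.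
    by rewrite [LHS]surjective_pairing [RHS]surjective_pairing f2 -uf1.
  have [uf2|_] := eqVneq u (val f).2; last by rewrite subrr scale0r sub0mx.
  apply: scalemx_sub; rewrite -uf2; apply: inO => //.
    by rewrite neq_ltn uf2 f12.
  by rewrite neq_ltn (ltn_trans _ ux) // uf2.
move=> /submx_trans/(_ sub)/submxP[a xa].
pose b z := if z == x then 1 else a 0 z.
have : {in V :\ u, forall z, b z = 0}.
  apply: (generic_indep (y := u) gen_p); first by rewrite setD11.
    by move: cardV; rewrite (cardsD1S uV).
  have xVu : x \in V :\ u by rewrite in_setD1 eq_sym nux.
  rewrite (big_setD1 x) //= /b eqxx scale1r.
  rewrite -[row x p - _]opprB xa mulmx_sum_row (bigID (mem (V :\ u :\ x))) /= opprD.
  rewrite [X in _ - X]big1 ?subr0 => [|z zV]; last first.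
    by rewrite rowK (negbTE zV) scaler0.
  rewrite -sumrN -big_split big1 //= => z zV; rewrite rowK zV.
  by move: zV; rewrite in_setD1 => /andP[/negbTE -> _]; rewrite addNr.
move=> /(_ x); rewrite in_setD1 eq_sym nux => /(_ xV); rewrite /b eqxx => /eqP.
by rewrite oner_eq0.
Qed.

(** On more than [d + 1] vertices the rank of [F] attains the upper bound for the complete graph.
    Otherwise [F] is empty, as is the 0-fold circuit arising for [k = 1]. *)
Lemma rigid_span (F : {set edge n}) : cyclic p F -> rigid p F ->
  (rig_mx p (complete_on (vspan F)) <= rig_mx p F)%MS.
Proof.
move=> cF rF; have [small|large] := leqP #|vspan F| d.+1.
  rewrite (cyclic_small cF small).
  apply/(@fam_mx_subP _ _ _ (rig_row p)) => e; rewrite !inE => /andP[/existsP[f]].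
  by rewrite inE.
case: rF => [[_]|rkF]; first by rewrite leqNgt large.
have sub := @fam_mxS _ _ _ (rig_row p) _ _ (subset_complete_vspan F).
rewrite -(geq_leqif (mxrank_leqif_sup sub)).
have := rk_complete_on (ltnW large).
by rewrite -rkF leq_add2r.
Qed.

End Equilibrium.

(** * From the intersection of spans to the intersection of closures *)

Theorem theorem3p16 (R : realType) (n d k : nat) (p : 'M[R]_(n, d))
    (D : {set edge n}) :
  (1 <= d)%N -> (1 <= k)%N ->
  generic p ->
  kfold_circuit p k D ->
  (forall C : {set edge n}, C \subset D -> kfold_circuit p k.-1 C -> rigid p C) ->
  balanced p k D.

Proof.
move=> _ k0 gen_p fD rigid_sub.
pose P := coclasses (rig_row p) D.
have dimW := rank_bigcap_coclasses k0 fD.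
exists P; split; first split.
- have [cD _] := fD; exact: (equivalence_partitionP (coparallel_equiv cD)).
- by move=> C; apply: coclasses_kfold.
(* The dimension of the intersection of the spans is known; what remains is that edges lying in all
   the closures span it. *)
suff spanE : (rig_mx p (\bigcap_(A in P) cl p (D :\: A)) ==
              \bigcap_(A in P) <<rig_mx p (D :\: A)>>)%MS.
  by rewrite /rk (eqmxP spanE) -dimW.
have in_cl (X : {set edge n}) e :
    (e \in cl p X) = (rig_row p e <= rig_mx p X)%MS.
  rewrite inE /rk; have /= := frk_setU1 (rig_row p) X e.
  rewrite /frk /fam_mx => ->; rewrite -[X in _ == X]addn0 eqn_add2l.
  by case: (_ <= _)%MS.
have span_sub A : A \in P ->
    (rig_mx p (complete_on (vspan (D :\: A))) <= rig_mx p (D :\: A))%MS.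
  move=> AP; have [sAD fA _] := kfold_setD_coclass k0 fD AP.
  have [cA _] := fA.
  by apply: rigid_span => //; apply: rigid_sub => //; apply: subsetDl.
apply/andP; split.
  apply/sub_bigcapmxP => A AP; rewrite genmxE.
  apply/(@fam_mx_subP _ _ _ (rig_row p)) => e /bigcapP/(_ A AP).
  by rewrite in_cl.
apply/rV_subP => v /sub_bigcapmxP vW.
pose X := \bigcap_(A in P) vspan (D :\: A).
have eqv A : A \in P -> equil p (vspan (D :\: A)) (vec_mx v).
  move=> AP; apply: equil_sub (subset_complete_vspan (D :\: A)) _.
  by have := vW A AP; rewrite genmxE.
(* One class is needed to supply the force and torque conditions; it exists because [k > 0]. *)
have /card_gt0P[A0 A0P] : 0 < #|P| by rewrite -dimW addn_gt0 k0 orbT.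
have eqX : equil p X (vec_mx v).
  have [_ force torque] := eqv _ A0P; split=> // x xX.
  have /existsP[A /andP[AP xA]] : [exists A in P, x \notin vspan (D :\: A)].
    apply: contraNT xX; rewrite negb_exists => /forallP xA.
    by apply/bigcapP => A AP; have := xA A; rewrite AP negbK.
  by have [supp _ _] := eqv A AP; apply: supp.
(* The load is resolved by the complete graph on [X], whose edges lie in each complete graph on
   [vspan (D :\: A)] and so in each closure. *)
rewrite -[v]vec_mxK; apply: submx_trans (equil_complete gen_p eqX) _.
apply: (@fam_mxS _ _ _ (rig_row p)); apply/subsetP => e eX.
apply/bigcapP => A AP; rewrite in_cl; apply: submx_trans (span_sub A AP).
apply: (@fam_row_sub _ _ _ (rig_row p)).
by apply: subsetP eX; apply/complete_onS/bigcap_inf.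
Qed.
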